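(* Consider the network with 2 CUs, 2 eRRHs and 2 CPs under an oblivious stationary randomized (OSR) policy with parameters $b_k^{(n)}$, $r_k$ ($n,k\in\{1,2\}$), and put $b_k=b_k^{(1)}+b_k^{(2)}$ and $\zeta_{nk}=1-(1-b_k^{(n)})^2$, all denominators below being nonzero. Then the average AoI $J_c$ of the CUs satisfies the two upper bounds $$J_c\le\frac12\sum_{k=1}^{2}\frac{1}{b_kr_k},$$ $$J_c\le\frac12\sum_{k=1}^{2}\Big(\frac{1-b_k+b_kr_k}{b_kr_k}+\sum_{n=1}^{2}\frac{b_k^{(n)}(1-r_k)}{r_k\zeta_{nk}}\Big).$$
   Context: Time is slotted, $t=0,1,2,\dots$; $m,n,k\in\{1,2\}$ index content users (CUs), eRRHs and content providers (CPs). An OSR policy is given by numbers $b_k^{(n)}\in[0,1]$ with $b_k:=b_k^{(1)}+b_k^{(2)}\le 1$ and $r_1\ge r_2$ in $[0,1]$. In slot $t$, $\beta_{mk}^{(n)}(t)\in\{0,1\}$ indicates that CU $m$ sends a request for CP $k$ to eRRH $n$; $\sum_n\beta_{mk}^{(n)}(t)\le 1$ and $\Pr(\beta_{mk}^{(n)}(t)=1)=b_k^{(n)}$. $\gamma_{nk}(t)\in\{0,1\}$ with $\Pr(\gamma_{nk}(t)=1)=r_k$ is the decision of eRRH $n$ to command CP $k$ to send a new packet (effective only if eRRH $n$ received a request for CP $k$). The vectors $(\beta_{mk}^{(n)}(t))_{n}$ are independent over $m$ and over $t$; the $\gamma_{nk}(t)$ are independent over $n,k,t$ and independent of the $\beta$'s.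 AoI at the eRRHs: $g_{nk}(0)=1$, and $g_{nk}(t+1)=1$ if $\gamma_{nk}(t)\sum_m\beta_{mk}^{(n)}(t)>0$, $g_{nk}(t+1)=g_{nk}(t)+1$ otherwise. AoI at the CUs: $h_{mk}(0)=1$, and $h_{mk}(t+1)=1$ if $\beta_{mk}^{(n)}(t)\gamma_{nk}(t)=1$ for some $n$; $h_{mk}(t+1)=\min\{h_{mk}(t),g_{nk}(t)\}+1$ if $\beta_{mk}^{(n)}(t)(1-\gamma_{nk}(t))=1$ for some $n$; $h_{mk}(t+1)=h_{mk}(t)+1$ if $\sum_n\beta_{mk}^{(n)}(t)=0$. The average AoI of CUs is $J_c=\lim_{T\to\infty}\frac1T\sum_{t=1}^T\frac14\sum_{m=1}^{2}\sum_{k=1}^{2}\mathbb{E}[h_{mk}(t)]$. *)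

(* Defs.v *)
From HB Require Import structures.
From mathcomp Require Import all_boot all_order all_algebra.
From mathcomp Require Import all_classical all_reals all_analysis.
Set Implicit Arguments.
Unset Strict Implicit.
Unset Printing Implicit Defensive.
Import Order.TTheory GRing.Theory Num.Theory.
Import numFieldNormedType.Exports.
Local Open Scope classical_set_scope.
Local Open Scope ring_scope.

(* Age of information (AoI) in a slotted network: content users (CUs) m, eRRHs n
   and content providers (CPs) k all range over 'I_2, so the index 1 is
   ord0 and the index 2 is ord_max.  The argument orders are
     b k n = b_k^(n),  beta m k n t = beta_mk^(n)(t),  gamma n k t = gamma_nk(t).
   The {0,1}-valued variables are bool-valued random variables. *)

(* The sigma-algebra generated by the family X; for a finite I this is the
   sigma-algebra of the random vector (X i)_i. *)
Definition sigma_gen (d : measure_display) (T : measurableType d) (I : Type)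
    (X : I -> T -> bool) : set_system T :=
  <<s \bigcup_i preimage_set_system setT (X i) measurable >>.

Definition mutually_independent (d : measure_display) (T : measurableType d)
    (R : realType) (P : probability T R) (I : eqType)
    (F : I -> set_system T) : Prop :=
  forall (s : seq I) (E : I -> set T), uniq s ->
    (forall i, i \in s -> F i (E i)) ->
    P (\bigcap_(i in [set` s]) E i) = (\prod_(i <- s) P (E i))%E.

Definition independent2 (d : measure_display) (T : measurableType d)
    (R : realType) (P : probability T R) (F G : set_system T) : Prop :=
  forall A B : set T, F A -> G B -> P (A `&` B) = (P A * P B)%E.

(* The coordinates beta_mk^(n)(t) for different k (and equal m, t) may be
   dependent.  The joint law of (beta_mk^(n)(t))_n is determined by its two
   marginals because at most one of its coordinates is 1. *)
Record OSR_process (d : measure_display) (T : measurableType d)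
    (R : realType) (P : probability T R)
    (b : 'I_2 -> 'I_2 -> R) (r : 'I_2 -> R)
    (beta : 'I_2 -> 'I_2 -> 'I_2 -> nat -> {RV P >-> bool})
    (gamma : 'I_2 -> 'I_2 -> nat -> {RV P >-> bool}) : Prop := {
  OSR_beta_le1 : forall m k t w, (\sum_(n < 2) beta m k n t w <= 1)%N;
  OSR_beta_law : forall m k n t, P [set w | beta m k n t w] = (b k n)%:E;
  OSR_gamma_law : forall n k t, P [set w | gamma n k t w] = (r k)%:E;
  OSR_beta_indep : forall k,
    mutually_independent P (fun mt : 'I_2 * nat =>
      sigma_gen (fun n : 'I_2 => beta mt.1 k n mt.2));
  OSR_gamma_indep :
    mutually_independent P (fun i : 'I_2 * 'I_2 * nat =>
      sigma_gen (fun _ : unit => gamma i.1.1 i.1.2 i.2));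
  OSR_beta_gamma_indep :
    independent2 P
      (sigma_gen (fun i : 'I_2 * 'I_2 * 'I_2 * nat =>
         beta i.1.1.1 i.1.1.2 i.1.2 i.2))
      (sigma_gen (fun i : 'I_2 * 'I_2 * nat => gamma i.1.1 i.1.2 i.2))
}.

Fixpoint eRRH_AoI (T : Type)
    (beta : 'I_2 -> 'I_2 -> 'I_2 -> nat -> T -> bool)
    (gamma : 'I_2 -> 'I_2 -> nat -> T -> bool)
    (n k : 'I_2) (t : nat) (w : T) : nat :=
  if t is s.+1 then
    if (0 < gamma n k s w * \sum_(m < 2) beta m k n s w)%N then 1%N
    else (eRRH_AoI beta gamma n k s w).+1
  else 1%N.

(* [pick n | _] is the eRRH to which user m sends its request for k, if any;
   it is unique under OSR_beta_le1. *)
Fixpoint CU_AoI (T : Type)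
    (beta : 'I_2 -> 'I_2 -> 'I_2 -> nat -> T -> bool)
    (gamma : 'I_2 -> 'I_2 -> nat -> T -> bool)
    (m k : 'I_2) (t : nat) (w : T) : nat :=
  if t is s.+1 then
    if [pick n | beta m k n s w] is Some n then
      if gamma n k s w then 1%N
      else (minn (CU_AoI beta gamma m k s w) (eRRH_AoI beta gamma n k s w)).+1
    else (CU_AoI beta gamma m k s w).+1
  else 1%N.

(* The value at the horizon N = 0 is 0 and is irrelevant to the limit. *)
Definition mean_CU_AoI (d : measure_display) (T : measurableType d)
    (R : realType) (P : probability T R)
    (beta : 'I_2 -> 'I_2 -> 'I_2 -> nat -> {RV P >-> bool})
    (gamma : 'I_2 -> 'I_2 -> nat -> {RV P >-> bool}) (N : nat) : \bar R :=
  ((N%:R^-1)%:E * \sum_(1 <= t < N.+1)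
     ((4^-1)%:E * \sum_(m < 2) \sum_(k < 2)
       'E_P[fun w => (CU_AoI (fun m k n t => beta m k n t)
                             (fun n k t => gamma n k t) m k t w)%:R]))%E.

Definition avg_CU_AoI (d : measure_display) (T : measurableType d)
    (R : realType) (P : probability T R)
    (beta : 'I_2 -> 'I_2 -> 'I_2 -> nat -> {RV P >-> bool})
    (gamma : 'I_2 -> 'I_2 -> nat -> {RV P >-> bool}) : \bar R :=
  limn (mean_CU_AoI beta gamma).

Definition btot (R : realType) (b : 'I_2 -> 'I_2 -> R) (k : 'I_2) : R :=
  \sum_(n < 2) b k n.

Definition zeta (R : realType) (b : 'I_2 -> 'I_2 -> R) (n k : 'I_2) : R :=
  1 - (1 - b k n) ^+ 2.

(* Main.v *)
(* For a fixed content k and user m, the pair (h, (g_1, g_2)) is a Markov chain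
   on integer vectors, driven by i.i.d. finitely valued slots and started at
   (1, (1, 1)).  One step is monotone and the start is the least state, so
   E[h(t)] is nondecreasing: an extra initial slot can only increase the ages.
   Conditioning on one slot gives
     E[h(t+1)] = 1 + (1 - b) E[h(t)] + (1 - r) sum_n b_n E[min(h(t), g_n(t))],
     E[g_n(t+1)] = 1 + (1 - r zeta_n) E[g_n(t)].
   Bounding the minimum by h(t) yields E[h(t)] <= 1/(b r), and the second
   recursion yields E[g_n(t)] <= 1/(r zeta_n).  Bounding the minimum by g_n(t)
   and the remaining E[h(t)] by 1/(b r) yields the second bound.  Monotone
   convergence and Cesaro's theorem then settle the time average. *)
Require Import Defs.
From HB Require Import structures.
From mathcomp Require Import all_boot all_order all_algebra.
From mathcomp Require Import all_classical all_reals all_analysis.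
From mathcomp Require Import measurable_realfun ring lra.
Set Implicit Arguments.
Unset Strict Implicit.
Unset Printing Implicit Defensive.
Import Order.TTheory GRing.Theory Num.Theory.
Import numFieldNormedType.Exports.
Local Open Scope classical_set_scope.
Local Open Scope ring_scope.

(** * Weighted sums over finite function spaces *)

Lemma big_option (V : nmodType) (J : finType) (F : option J -> V) :
  \sum_o F o = F None + \sum_j F (Some j).
Proof.
rewrite (bigD1 None) //=; congr (_ + _).
rewrite (reindex_omap Some id) => [|[]//]; apply: eq_bigl => j.
by rewrite /= eqxx.
Qed.

(** Under the product law of i.i.d. coordinates, an observable of one coordinate sees only that
    marginal: [F] is absorbed into the [i]-th factor, the product is distributed over the sum, and
    every other factor sums to 1. *)
Lemma sum_ffun_marginal (R : comPzSemiRingType) (I J : finType) (p F : J -> R)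
    (i : I) : \sum_j p j = 1 ->
  \sum_(f : {ffun I -> J}) (\prod_l p (f l)) * F (f i) = \sum_j p j * F j.
Proof.
move=> p1.
transitivity (\sum_(f : {ffun I -> J})
    \prod_l (p (f l) * if l == i then F (f l) else 1)).
  apply: eq_bigr => f _; rewrite big_split /=; congr (_ * _).
  by rewrite -big_mkcond big_pred1_eq.
rewrite -(bigA_distr_bigA (fun l j => p j * if l == i then F j else 1)).
rewrite (bigD1 i) //= eqxx [X in _ * X]big1 ?mulr1// => l /negPf ->.
by under eq_bigr do rewrite mulr1.
Qed.

Lemma sum_ffun_cst (R : comPzSemiRingType) (I J : finType) (p : J -> R)
    (c : R) : \sum_j p j = 1 ->
  \sum_(f : {ffun I -> J}) (\prod_l p (f l)) * c = c.
Proof.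
by move=> p1; rewrite -big_distrl /= -(bigA_distr_bigA (fun=> p)) big1 ?mul1r.
Qed.

Lemma sum_ffun_forall (R : comPzSemiRingType) (I J : finType) (p : J -> R)
    (Q : pred J) :
  \sum_(f : {ffun I -> J}) (\prod_l p (f l)) * [forall l, Q (f l)]%:R =
  (\sum_(j | Q j) p j) ^+ #|I|.
Proof.
rewrite -[RHS]prodr_const (bigA_distr_big Q (fun _ => p)) [RHS]big_mkcond /=.
apply: eq_bigr => f _; rewrite (_ : (f \in ffun_on Q) = [forall l, Q (f l)]).
  by case: ifP; rewrite ?mulr1 ?mulr0.
by apply/ffun_onP/forallP.
Qed.

(** * The age chain of one user and one content *)

(* Requested eRRH of each user, and command of each eRRH, for one content. *)
Definition slot := ({ffun 'I_2 -> option 'I_2} * {ffun 'I_2 -> bool})%type.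

(* AoI of the observed user, and AoI of each eRRH. *)
Definition ages := (nat * ('I_2 -> nat))%type.

Definition step (m : 'I_2) (s : slot) (x : ages) : ages :=
  (if s.1 m is Some n then
     if s.2 n then 1%N else (minn x.1 (x.2 n)).+1
   else x.1.+1,
   fun n => if s.2 n && [exists l, s.1 l == Some n] then 1%N
            else (x.2 n).+1).

Definition fresh : ages := (1%N, fun=> 1%N).

Section Chain.
Variables (R : realType) (b : 'I_2 -> R) (r : R).
Let B := \sum_n b n.

Definition request_prob (o : option 'I_2) : R :=
  if o is Some n then b n else 1 - \sum_n b n.

Definition command_prob (c : bool) : R := if c then r else 1 - r.

Definition slot_prob (s : slot) : R :=
  (\prod_m request_prob (s.1 m)) * \prod_n command_prob (s.2 n).

(** The transition operator of the chain, acting on observables; its [t]-th iterate evaluated at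
    [fresh] is the expectation after [t] slots. *)
Definition expect_step (m : 'I_2) (f : ages -> R) (x : ages) : R :=
  \sum_s slot_prob s * f (step m s x).

Definition expect_AoI (m : 'I_2) (t : nat) (f : ages -> R) : R :=
  iter t (expect_step m) f fresh.

Lemma expect_stepE m f x :
  expect_step m f x = \sum_s slot_prob s * f (step m s x).
Proof. by []. Qed.

Lemma sum_request_prob : \sum_o request_prob o = 1.
Proof. by rewrite big_option /= subrK. Qed.

Lemma sum_command_prob : \sum_c command_prob c = 1.
Proof. by rewrite big_bool /= addrC subrK. Qed.

Lemma sum_slotE (F : {ffun 'I_2 -> option 'I_2} -> {ffun 'I_2 -> bool} -> R) :
  \sum_s slot_prob s * F s.1 s.2 =
  \sum_(u : {ffun _}) (\prod_m request_prob (u m)) *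
     \sum_(c : {ffun _}) (\prod_n command_prob (c n)) * F u c.
Proof.
rewrite -(pair_bigA _ (fun u c => slot_prob (u, c) * F u c)) /=.
apply: eq_bigr => u _; rewrite big_distrr /=.
by apply: eq_bigr => c _; rewrite /slot_prob mulrA.
Qed.

Lemma sum_slot_prob : \sum_s slot_prob s = 1.
Proof.
under eq_bigr do rewrite -[slot_prob _]mulr1.
rewrite (sum_slotE (fun _ _ => 1)).
under eq_bigr do rewrite (sum_ffun_cst _ _ sum_command_prob).
exact: sum_ffun_cst sum_request_prob.
Qed.

Lemma expect_step_CU (m : 'I_2) (x : ages) :
  expect_step m (fun y => y.1%:R) x =
  1 + (1 - B) * x.1%:R + \sum_n b n * (1 - r) * (minn x.1 (x.2 n))%:R.
Proof.
pose F (u : {ffun 'I_2 -> option 'I_2}) (c : {ffun 'I_2 -> bool}) :=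
  (step m (u, c) x).1%:R : R.
rewrite /expect_step (sum_slotE F).
(* [G] is the conditional mean of the new age given the request of user [m]: only the command of the
   requested eRRH matters. *)
pose G (o : option 'I_2) : R := if o is Some n then
  1 + (1 - r) * (minn x.1 (x.2 n))%:R else 1 + x.1%:R.
transitivity (\sum_(u : {ffun 'I_2 -> option 'I_2})
    (\prod_l request_prob (u l)) * G (u m)).
  apply: eq_bigr => u _; congr (_ * _); rewrite /F /step /=.
  case: (u m) => [n|] /=.
    rewrite (sum_ffun_marginal (fun c : bool =>
      (if c then 1 else (minn x.1 (x.2 n)).+1)%:R) n sum_command_prob).
    rewrite big_bool /= -(natr1 (minn _ _)); set M := (minn _ _)%:R; ring.
  by rewrite (sum_ffun_cst _ _ sum_command_prob) -natr1 addrC.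
rewrite (sum_ffun_marginal G m sum_request_prob) big_option /=.
under [X in _ + X]eq_bigr do rewrite mulrDr mulr1 mulrA.
by rewrite big_split /= -/B; ring.
Qed.

(** Given a command, the age survives only if neither user requests [n]; the two users are
    independent, hence the square. *)
Lemma expect_step_eRRH (m n : 'I_2) (x : ages) :
  expect_step m (fun y => (y.2 n)%:R) x =
  1 + (1 - r * (1 - (1 - b n) ^+ 2)) * (x.2 n)%:R.
Proof.
pose F (u : {ffun 'I_2 -> option 'I_2}) (c : {ffun 'I_2 -> bool}) :=
  ((step m (u, c) x).2 n)%:R : R.
rewrite /expect_step (sum_slotE F).
transitivity (\sum_(u : {ffun 'I_2 -> option 'I_2})
    (\prod_l request_prob (u l)) *
      (1 + (1 - r) * (x.2 n)%:R + r * (x.2 n)%:R *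
         [forall l, u l != Some n]%:R)).
  apply: eq_bigr => u _; congr (_ * _).
  rewrite /F /step /= -negb_exists; set e := [exists l, _].
  rewrite (sum_ffun_marginal (fun c : bool =>
    (if c && e then 1 else (x.2 n).+1)%:R) n sum_command_prob).
  by rewrite big_bool /= -(natr1 (x.2 n)); case: e => /=; ring.
under eq_bigr do rewrite mulrDr mulrCA.
rewrite big_split /= (sum_ffun_cst _ _ sum_request_prob) -big_distrr /=.
have /= -> := @sum_ffun_forall R 'I_2 _ request_prob (fun o => o != Some n).
rewrite card_ord.
have /eqP := sum_request_prob; rewrite (bigD1 (Some n)) //= => /eqP E.
have -> : \sum_(o | o != Some n) request_prob o = 1 - b n by rewrite -E; ring.
by ring.
Qed.

(** * Positivity, linearity and monotonicity of the transition operator *)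

Hypotheses (b_ge0 : forall n, 0 <= b n) (B_le1 : B <= 1) (r01 : 0 <= r <= 1).

Lemma request_prob_ge0 o : 0 <= request_prob o.
Proof. by case: o => [n|] /=; rewrite ?b_ge0 ?subr_ge0. Qed.

Lemma slot_prob_ge0 s : 0 <= slot_prob s.
Proof.
have [r0 r1] := andP r01.
by rewrite mulr_ge0// prodr_ge0// => i _;
  [exact: request_prob_ge0 | rewrite /command_prob; case: ifP; rewrite ?subr_ge0].
Qed.

Lemma iter_expect_step_le (m : 'I_2) (t : nat) (f g : ages -> R) :
  (forall x, f x <= g x) ->
  forall x, iter t (expect_step m) f x <= iter t (expect_step m) g x.
Proof.
move=> fg; elim: t => //= t IH x.
by apply: ler_sum => s _; rewrite ler_wpM2l ?slot_prob_ge0.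
Qed.

(** The operator is linear and fixes constants because the slot weights sum to 1. *)
Lemma iter_expect_step_affine (m : 'I_2) (t : nat) (c a : R) (e : 'I_2 -> R)
    (f : ages -> R) (g : 'I_2 -> ages -> R) (x : ages) :
  iter t (expect_step m) (fun y => c + a * f y + \sum_n e n * g n y) x =
  c + a * iter t (expect_step m) f x +
  \sum_n e n * iter t (expect_step m) (g n) x.
Proof.
pose E := expect_stepE m; elim: t x => //= t IH x; rewrite !E.
under [X in X = _]eq_bigr do rewrite IH !mulrDr mulr_sumr.
under [X in _ = _ + X]eq_bigr do rewrite E mulr_sumr.
rewrite !big_split /= -big_distrl /= sum_slot_prob mul1r exchange_big /=.
congr (_ + _ + _); first by rewrite mulr_sumr; apply: eq_bigr => s _; ring.
by apply: eq_bigr => n _; apply: eq_bigr => s _; ring.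
Qed.

(** Turns a pointwise one-slot estimate into a recursion between expectations: the estimate is
    applied to the last slot, then the other [t] slots are averaged by positivity and linearity. *)
Lemma expect_AoI_affine (m : 'I_2) (t : nat) (c a : R) (e : 'I_2 -> R)
    (f : ages -> R) (g : 'I_2 -> ages -> R) :
  (forall y, expect_step m f y <= c + a * f y + \sum_n e n * g n y) ->
  expect_AoI m t.+1 f <=
  c + a * expect_AoI m t f + \sum_n e n * expect_AoI m t (g n).
Proof.
move=> H; rewrite /expect_AoI iterSr -iter_expect_step_affine.
exact: iter_expect_step_le.
Qed.

Definition ages_le (x y : ages) : Prop :=
  (x.1 <= y.1)%N /\ forall n, (x.2 n <= y.2 n)%N.

Lemma step_homo m s x y : ages_le x y -> ages_le (step m s x) (step m s y).
Proof.
move=> [h g]; split => [|n] /=; last by case: ifP => // _; rewrite ltnS.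
case: (s.1 m) => [n|//]; case: ifP => // _.
by rewrite ltnS leq_min !geq_min h g orbT.
Qed.

Lemma iter_expect_step_homo m t (f : ages -> R) :
  (forall x y, ages_le x y -> f x <= f y) ->
  forall x y, ages_le x y ->
    iter t (expect_step m) f x <= iter t (expect_step m) f y.
Proof.
move=> fH; elim: t => //= t IH x y xy.
apply: ler_sum => s _; rewrite ler_wpM2l ?slot_prob_ge0//.
exact/IH/step_homo.
Qed.

Lemma fresh_le_step m s : ages_le fresh (step m s fresh).
Proof.
by split => [|n] /=; [case: (s.1 m) => [n|//]|]; case: ifP.
Qed.

Definition mean_CU (m : 'I_2) (t : nat) : R := expect_AoI m t (fun x => x.1%:R).

(* The chain run for t + 1 slots is the chain run for t slots from a random
   state above [fresh]. *)
Lemma mean_CU_nondecreasing m : nondecreasing_seq (mean_CU m).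
Proof.
apply/nondecreasing_seqP => t; rewrite /mean_CU /expect_AoI iterS.
rewrite -[leLHS]mul1r -[X in X * _]sum_slot_prob big_distrl /=.
apply: ler_sum => s _; rewrite ler_wpM2l ?slot_prob_ge0//.
apply: iter_expect_step_homo => [x y [xy _]|]; first by rewrite ler_nat.
exact: fresh_le_step.
Qed.

(** * Uniform bounds on the expected ages *)

Hypotheses (Br_neq0 : B * r != 0).

Let B_ge0 : 0 <= B. Proof. exact: sumr_ge0. Qed.

Let Br_gt0 : 0 < B * r.
Proof. by rewrite lt_def Br_neq0 mulr_ge0//; case/andP: r01. Qed.

Lemma mean_CU_le_inv m t : mean_CU m t <= (B * r)^-1.
Proof.
have [r0 r1] := andP r01.
elim: t => [|t IH].
  by rewrite /mean_CU /expect_AoI /= invf_ge1// mulr_ile1.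
(* Each [g n] is taken to be the user's own age, which bounds the minimum and closes the
   recursion. *)
have /= := @expect_AoI_affine m t 1 (1 - B) (fun n => b n * (1 - r))
  (fun x => x.1%:R) (fun _ x => x.1%:R).
rewrite -big_distrl /= -big_distrl /= -/B -/(mean_CU m t) -/(mean_CU m t.+1).
move=> /(_ _)/le_trans; apply.
  move=> y; rewrite expect_step_CU lerD2l; apply: ler_sum => n _.
  by rewrite ler_wpM2l ?mulr_ge0 ?subr_ge0// ler_nat geq_minl.
have -> : 1 + (1 - B) * mean_CU m t + B * (1 - r) * mean_CU m t =
  1 + (1 - B * r) * mean_CU m t by ring.
(* The bound is the fixed point of the affine recursion, so it is preserved from one slot to the
   next. *)
have -> : (B * r)^-1 = 1 + (1 - B * r) * (B * r)^-1.
  by rewrite mulrBl mul1r divff// addrC subrK.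
by rewrite lerD2l ler_wpM2l// subr_ge0 mulr_ile1.
Qed.

Lemma mean_eRRH_le_inv m n t : b n <= 1 ->
  r * (1 - (1 - b n) ^+ 2) != 0 ->
  expect_AoI m t (fun x => (x.2 n)%:R) <= (r * (1 - (1 - b n) ^+ 2))^-1.
Proof.
move=> bn1; have [r0 r1] := andP r01; have b0 := b_ge0 n.
set z := r * _ => z0.
have z01 : 0 <= z <= 1.
  by rewrite /z mulr_ge0 ?mulr_ile1//; nra.
have [zge0 z1] := andP z01.
have z_gt0 : 0 < z by rewrite lt_def z0.
elim: t => [|t IH]; first by rewrite /expect_AoI /= invf_ge1.
have /= := @expect_AoI_affine m t 1 (1 - z) (fun=> 0)
  (fun x => (x.2 n)%:R) (fun _ => fun=> 0).
rewrite [X in _ -> _ <= _ + X]big1 ?addr0 => [|i _]; last by rewrite mul0r.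
move=> /(_ _)/le_trans; apply.
  by move=> y; rewrite expect_step_eRRH big1 ?addr0 // => i _; rewrite mul0r.
have -> : z^-1 = 1 + (1 - z) * z^-1.
  by rewrite mulrBl mul1r divff// addrC subrK.
by rewrite lerD2l ler_wpM2l// subr_ge0.
Qed.

Lemma mean_CU_le_eRRH m t : (forall n, b n <= 1) ->
  (forall n, r * (1 - (1 - b n) ^+ 2) != 0) ->
  mean_CU m t <= (1 - B + B * r) / (B * r) +
    \sum_n b n * (1 - r) / (r * (1 - (1 - b n) ^+ 2)).
Proof.
move=> bn1 z0; have [r0 r1] := andP r01.
have -> : (1 - B + B * r) / (B * r) = 1 + (1 - B) * (B * r)^-1.
  by rewrite mulrDl divff// addrC.
have z_gt0 n : 0 < r * (1 - (1 - b n) ^+ 2).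
  rewrite lt_def z0 mulr_ge0//; have := b_ge0 n; have := bn1 n; nra.
(* The recursion only reaches positive times; at time 0 the age is 1, and the right-hand side is 1
   plus nonnegative terms. *)
case: t => [|t].
  rewrite /mean_CU /expect_AoI /= -addrA lerDl addr_ge0//.
    by rewrite mulr_ge0 ?subr_ge0// invr_ge0 ltW.
  apply: sumr_ge0 => n _; apply: divr_ge0; last exact: ltW.
  by rewrite mulr_ge0 ?subr_ge0.
have /= := @expect_AoI_affine m t 1 (1 - B) (fun n => b n * (1 - r))
  (fun x => x.1%:R) (fun n x => (x.2 n)%:R).
rewrite -/(mean_CU m t) -/(mean_CU m t.+1).
move=> /(_ _)/le_trans; apply.
  move=> y; rewrite expect_step_CU lerD2l; apply: ler_sum => n _.
  by rewrite ler_wpM2l ?mulr_ge0 ?subr_ge0// ler_nat geq_minr.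
apply: lerD; first by rewrite lerD2l ler_wpM2l ?subr_ge0 ?mean_CU_le_inv.
apply: ler_sum => n _; rewrite ler_wpM2l ?mulr_ge0 ?subr_ge0//.
exact: mean_eRRH_le_inv.
Qed.

End Chain.

(** * Identification of the process with the chain *)

Lemma measurable_fun_bigsetU (d d' : measure_display) (T : sigmaRingType d)
    (U : sigmaRingType d') (I : Type) (s : seq I) (F : I -> set T)
    (f : T -> U) :
  (forall i, measurable (F i)) -> (forall i, measurable_fun (F i) f) ->
  measurable_fun (\big[setU/set0]_(i <- s) F i) f.
Proof.
move=> mF mf; elim: s => [|i s IH].
  by rewrite big_nil; exact: measurable_fun_set0.
rewrite big_cons; apply/measurable_funU => //.
by apply: bigsetU_measurable.
Qed.

(** * Events in generated sigma-algebras *)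

Section SigmaGen.
Variables (d : measure_display) (T : measurableType d).

Lemma sigma_gen_comp (I J : Type) (X : I -> T -> bool) (h : J -> I) :
  sigma_gen (fun j => X (h j)) `<=` sigma_gen X.
Proof.
apply: sub_sigma_algebra2 => A [j _ [B mB <-]].
by exists (h j) => //; exists B.
Qed.

Lemma sigma_gen_fiber (I : Type) (X : I -> T -> bool) (i : I) (c : bool) :
  sigma_gen X [set w | X i w = c].
Proof.
apply: sub_sigma_algebra; exists i => //; exists [set c] => //.
by rewrite setTI.
Qed.

Lemma sigma_gen_bigcap (I K : Type) (X : I -> T -> bool) (D : set K)
    (F : K -> set T) : finite_set D -> (forall i, D i -> sigma_gen X (F i)) ->
  sigma_gen X (\bigcap_(i in D) F i).
Proof.
pose G := \bigcup_i preimage_set_system setT (X i) measurable.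
exact: (@fin_bigcap_measurable _ (g_sigma_algebraType G)).
Qed.

Lemma sigma_gen_measurable (R : realType) (P : probability T R) (I : Type)
    (X : I -> {RV P >-> bool}) (A : set T) :
  sigma_gen (fun i => X i) A -> measurable A.
Proof.
move: A; apply: smallest_sub; first exact: sigma_algebra_measurable.
by move=> A [i _ [B mB <-]]; exact: measurable_funP.
Qed.

End SigmaGen.

(** * Slots as random variables and their laws *)

Section Process.
Variables (R : realType) (d : measure_display) (T : measurableType d).
Variables (P : probability T R) (b : 'I_2 -> 'I_2 -> R) (r : 'I_2 -> R).
Variables (beta : 'I_2 -> 'I_2 -> 'I_2 -> nat -> {RV P >-> bool}).
Variables (gamma : 'I_2 -> 'I_2 -> nat -> {RV P >-> bool}).
Hypothesis OSR : OSR_process b r beta gamma.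
Variable k : 'I_2.

Definition request (m : 'I_2) (t : nat) (w : T) : option 'I_2 :=
  [pick n | beta m k n t w].

Definition slot_at (t : nat) (w : T) : slot :=
  ([ffun m => request m t w], [ffun n => gamma n k t w]).

Definition ages_at (m : 'I_2) (t : nat) (w : T) : ages :=
  (CU_AoI (fun m k n t => beta m k n t) (fun n k t => gamma n k t) m k t w,
   fun n => eRRH_AoI (fun m k n t => beta m k n t) (fun n k t => gamma n k t)
              n k t w).

(** A user sends at most one request per slot, so [pick] can only return the eRRH actually
    requested. *)
Lemma request_eqSome m n t w : (request m t w == Some n) = beta m k n t w.
Proof.
rewrite /request; case: pickP => [n' bn'|/(_ n) ->//].
apply/eqP/idP => [[<-//]|bn]; congr Some; apply/eqP/negPn/negP => nn'.
have := OSR_beta_le1 OSR m k t w.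
by rewrite (bigD1 n) //= (bigD1 n') //= bn bn'.
Qed.

Lemma ages_atS m t w : ages_at m t.+1 w = step m (slot_at t w) (ages_at m t w).
Proof.
rewrite /ages_at /step /=; congr pair.
  by rewrite ffunE /request; case: pickP => // n _; rewrite ffunE.
apply/funext => n; rewrite ffunE; congr (if _ then _ else _).
rewrite muln_gt0 lt0b; congr (_ && _).
rewrite lt0n sum_nat_eq0 negb_forall; apply: eq_existsb => l.
by rewrite ffunE request_eqSome /= eqb0 negbK.
Qed.

Lemma request_sigma m t o :
  sigma_gen (fun n => beta m k n t) [set w | request m t w = o].
Proof.
case: o => [n|].
  rewrite (_ : mkset _ = [set w | beta m k n t w = true]).
    exact: (@sigma_gen_fiber d T _ (fun n w => beta m k n t w) n).
  apply/seteqP; split => w /=; first by move/eqP; rewrite request_eqSome.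
  by rewrite -request_eqSome => /eqP.
rewrite (_ : mkset _ = \bigcap_(n in [set: 'I_2])
    [set w | beta m k n t w = false]).
  apply: sigma_gen_bigcap => // n _.
  exact: (@sigma_gen_fiber d T _ (fun n w => beta m k n t w) n).
apply/seteqP; split => w /=; rewrite /request; case: pickP => //.
  by move=> bF _ n _; exact: bF.
by move=> n bn /(_ n I) /=; rewrite bn.
Qed.

Lemma request_law m t o :
  P [set w | request m t w = o] = (request_prob (b k) o)%:E.
Proof.
have SomeE n : [set w | request m t w = Some n] = [set w | beta m k n t w].
  apply/seteqP; split => w /=; first by move/eqP; rewrite request_eqSome.
  by rewrite -request_eqSome => /eqP.
case: o => [n|]; first by rewrite SomeE (OSR_beta_law OSR).
have mreq o : measurable [set w | request m t w = o].
  exact: (sigma_gen_measurable (@request_sigma m t o)).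
(* The law of [None] follows by complementing the two disjoint request events. *)
have <- : ~` ([set w | request m t w = Some ord0] `|`
              [set w | request m t w = Some ord_max]) =
          [set w | request m t w = None].
  apply/seteqP; split => w /=; last by move=> -> [].
  case E: (request m t w) => [[[|[|//]] i]|//] []; [left|right];
    by congr Some; apply/val_inj.
rewrite probability_setC ?measureU//=; last 2 first.
- by rewrite -subset0 => w /= [-> ].
- exact: measurableU.
rewrite !SomeE !(OSR_beta_law OSR) big_ord_recl big_ord1.
by rewrite (_ : lift _ _ = ord_max)//; apply/val_inj.
Qed.

Lemma command_sigma n t c :
  sigma_gen (fun _ : unit => gamma n k t) [set w | gamma n k t w = c].
Proof. exact: (@sigma_gen_fiber d T unit (fun _ w => gamma n k t w) tt c). Qed.

Lemma command_law n t c :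
  P [set w | gamma n k t w = c] = (command_prob (r k) c)%:E.
Proof.
have trueE : P [set w | gamma n k t w = true] = (r k)%:E.
  exact: (OSR_gamma_law OSR).
case: c => //=.
rewrite (_ : mkset _ = ~` [set w | gamma n k t w = true]).
  rewrite probability_setC ?trueE//.
  exact: (sigma_gen_measurable (@command_sigma n t true)).
by apply/seteqP; split => w /=; case: (gamma n k t w).
Qed.

(** * Probabilities of cylinders of slot histories *)

Let s0 : slot := ([ffun=> None], [ffun=> false]).

Definition cylinder (s : seq slot) : set T :=
  [set w | forall i, (i < size s)%N -> slot_at i w = nth s0 s i].

(** The half of a cylinder that concerns requests. It is indexed by a list of pairs (user, time),
    the form that mutual independence of the requests takes. *)
Definition requests_cylinder (s : seq slot) : set T :=
  \bigcap_(j in [set` [seq (m, i) | i <- iota 0 (size s), m <- enum 'I_2]])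
    [set w | request j.1 j.2 w = (nth s0 s j.2).1 j.1].

Definition commands_cylinder (s : seq slot) : set T :=
  \bigcap_(j in [set` [seq (n, k, i) | i <- iota 0 (size s), n <- enum 'I_2]])
    [set w | gamma j.1.1 k j.2 w = (nth s0 s j.2).2 j.1.1].

Lemma cylinderE s : cylinder s = requests_cylinder s `&` commands_cylinder s.
Proof.
apply/seteqP; split => w /=.
  move=> H; split => j /= /allpairsP[[i n] /= []].
    rewrite mem_iota add0n => /H E _ ->.
    by rewrite -E /= ffunE.
  rewrite mem_iota add0n => /H E _ ->.
  by rewrite -E /= ffunE.
move=> [HB HG] i si.
rewrite [RHS]surjective_pairing /slot_at; congr pair; apply/ffunP => n.
  rewrite ffunE; apply: (HB (n, i)) => /=; apply/allpairsP.
  by exists (i, n); rewrite mem_iota mem_enum.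
rewrite ffunE; apply: (HG (n, k, i)) => /=; apply/allpairsP.
by exists (i, n); rewrite mem_iota mem_enum.
Qed.

Lemma requests_cylinder_sigma s :
  sigma_gen (fun i : 'I_2 * 'I_2 * 'I_2 * nat =>
    beta i.1.1.1 i.1.1.2 i.1.2 i.2) (requests_cylinder s).
Proof.
apply: sigma_gen_bigcap => [|[m i] _ /=]; first exact: finite_seq.
apply: (@sigma_gen_comp _ _ _ _ _ (fun n => (m, k, n, i))).
exact: request_sigma.
Qed.

Lemma commands_cylinder_sigma s :
  sigma_gen (fun i : 'I_2 * 'I_2 * nat => gamma i.1.1 i.1.2 i.2)
    (commands_cylinder s).
Proof.
apply: sigma_gen_bigcap => [|[[n k'] i] _ /=]; first exact: finite_seq.
apply: (@sigma_gen_comp _ _ _ _ _ (fun _ : unit => (n, k, i))).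
exact: command_sigma.
Qed.

Lemma measurable_cylinder s : measurable (cylinder s).
Proof.
rewrite cylinderE; apply: measurableI.
  exact: (sigma_gen_measurable (@requests_cylinder_sigma s)).
exact: (sigma_gen_measurable (@commands_cylinder_sigma s)).
Qed.

(** Independence of requests and commands separates the two halves, mutual independence factors each
    of them, and the factors are regrouped slot by slot. *)
Lemma cylinder_prob s :
  P (cylinder s) = (\prod_(x <- s) slot_prob (b k) (r k) x)%:E.
Proof.
have uniq_idx (J : eqType) (h : nat -> 'I_2 -> J) :
    (forall i n i' n', h i n = h i' n' -> (i, n) = (i', n')) ->
    uniq [seq h i n | i <- iota 0 (size s), n <- enum 'I_2].
  move=> h_inj; apply: allpairs_uniq; rewrite ?iota_uniq ?enum_uniq//.
  by move=> [i n] [i' n'] _ _ /h_inj.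
rewrite cylinderE (OSR_beta_gamma_indep OSR); last 2 first.
- exact: requests_cylinder_sigma.
- exact: commands_cylinder_sigma.
rewrite (OSR_beta_indep OSR (k := k)); last 2 first.
- by apply: uniq_idx => i n i' n' [-> ->].
- by move=> [m i] _; exact: request_sigma.
rewrite (OSR_gamma_indep OSR); last 2 first.
- by apply: uniq_idx => i n i' n' [-> ->].
- move=> [[n k'] i] /allpairsP[[i' n'] [_ _ [-> -> ->]]].
  exact: command_sigma.
rewrite !big_allpairs_dep /=.
under eq_bigr do under eq_bigr do rewrite request_law.
under [X in (_ * X)%E]eq_bigr do under eq_bigr do rewrite command_law.
under eq_bigr do rewrite prodEFin big_enum.
under [X in (_ * X)%E]eq_bigr do rewrite prodEFin big_enum.
rewrite !prodEFin -EFinM -big_split /= (big_nth s0) /index_iota subn0.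
by [].
Qed.

Lemma cylinder_rcons s x :
  cylinder (rcons s x) = cylinder s `&` [set w | slot_at (size s) w = x].
Proof.
apply/seteqP; split => w /=.
  rewrite /cylinder /= size_rcons => H; split => [i si|].
    by rewrite H ?ltnS 1?ltnW// nth_rcons si.
  by rewrite H // nth_rcons ltnn eqxx.
move=> [H <-] i; rewrite size_rcons ltnS leq_eqVlt nth_rcons.
by case: ltngtP => // [/H//|-> _].
Qed.

Lemma ages_at_cylinder m s w : cylinder s w ->
  ages_at m (size s) w = foldl (fun y x => step m x y) fresh s.
Proof.
elim/last_ind: s => [//|s x IH]; rewrite cylinder_rcons => -[/IH E /= sx].
by rewrite size_rcons ages_atS E sx foldl_rcons.
Qed.


(* Splitting the first slot after the cylinder, rather than the last one, makes
   the induction need only that the probability of a cylinder is a product. *)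
Lemma integral_cylinder m (f : ages -> R) (t : nat) (s : seq slot) :
  (forall y, 0 <= f y) ->
  measurable_fun (cylinder s)
    (fun w => f (ages_at m (size s + t) w)) /\
  (\int[P]_(w in cylinder s) (f (ages_at m (size s + t) w))%:E =
   (\prod_(x <- s) slot_prob (b k) (r k) x *
    iter t (expect_step (b k) (r k) m) f
      (foldl (fun y x => step m x y) fresh s))%:E)%E.
Proof.
move=> f0; elim: t s => [|t IH] s.
  (* With no slot left, the integrand is constant on the cylinder, since the history determines the
     ages. *)
  rewrite addn0; set y := foldl _ _ s.
  have E w : w \in cylinder s -> f y = f (ages_at m (size s) w).
    by move=> /set_mem /ages_at_cylinder ->.
  split; first exact: eq_measurable_fun E (measurable_cst _).
  rewrite (eq_integral (cst (f y)%:E)) => [|w /E <-//].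
  rewrite (integral_cst P (measurable_cylinder s)).
  by rewrite [X in (_ * X)%E](cylinder_prob s) -EFinM mulrC.
(* The value of the next slot partitions the cylinder into finitely many pieces, which yields
   measurability as well as one application of [expect_step]. *)
have sE : cylinder s = \big[setU/set0]_(x : slot) cylinder (rcons s x).
  apply/seteqP; split => w.
    move=> sw; rewrite -bigcup_seq; exists (slot_at (size s) w).
      by rewrite /= mem_index_enum.
    by rewrite cylinder_rcons.
  by rewrite -bigcup_seq => -[x _]; rewrite cylinder_rcons => -[].
have szE x : (size s + t.+1 = size (rcons s x) + t)%N.
  by rewrite size_rcons addSnnS.
have mf : measurable_fun (cylinder s)
    (fun w => f (ages_at m (size s + t.+1) w)).
  rewrite sE; apply: measurable_fun_bigsetU => x.
    exact: measurable_cylinder.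
  by rewrite (szE x); case: (IH (rcons s x)).
split => //; rewrite [in LHS]sE ge0_integral_bigsetU.
- rewrite iterS /expect_step mulr_sumr -sumEFin; apply: eq_bigr => x _.
  rewrite (szE x); have [_ ->] := IH (rcons s x).
  by rewrite -cats1 big_cat big_seq1 cats1 foldl_rcons mulrA.
- by move=> x; exact: measurable_cylinder.
- exact: index_enum_uniq.
- move=> x y _ _ [w []]; rewrite !cylinder_rcons.
  by move=> [_ /= <-] [_ /= <-].
- by apply/measurable_EFinP; rewrite -sE.
- by move=> w _; rewrite lee_fin.
Qed.

Lemma mean_CU_AoIE m t :
  ('E_P[fun w => (CU_AoI (fun m k n t => beta m k n t)
                         (fun n k t => gamma n k t) m k t w)%:R])%E =
  (mean_CU (b k) (r k) m t)%:E.
Proof.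
have [_] := @integral_cylinder m (fun y => y.1%:R) t [::] (fun=> ler0n _ _).
rewrite big_nil mul1r unlock => <-.
(* The empty history imposes no constraint, so its cylinder is the whole space. *)
by rewrite (_ : cylinder [::] = setT)// -subTset.
Qed.

End Process.

(** * Convergence of the time average and the two bounds *)

Theorem theorem2 (R : realType) (d : measure_display) (T : measurableType d)
    (P : probability T R)
    (b : 'I_2 -> 'I_2 -> R) (r : 'I_2 -> R)
    (beta : 'I_2 -> 'I_2 -> 'I_2 -> nat -> {RV P >-> bool})
    (gamma : 'I_2 -> 'I_2 -> nat -> {RV P >-> bool})
    (hb : forall k n, 0 <= b k n <= 1)
    (hbtot : forall k, btot b k <= 1)
    (hr : forall k, 0 <= r k <= 1)
    (hr12 : r ord_max <= r ord0)
    (hbr : forall k, btot b k * r k != 0)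
    (hrz : forall n k, r k * zeta b n k != 0)
    (hOSR : OSR_process b r beta gamma) :
  [/\ cvgn (mean_CU_AoI beta gamma),
      (avg_CU_AoI beta gamma <=
        (2^-1 * \sum_(k < 2) (btot b k * r k)^-1)%:E)%E &
      (avg_CU_AoI beta gamma <=
        (2^-1 * \sum_(k < 2)
           ((1 - btot b k + btot b k * r k) / (btot b k * r k) +
            \sum_(n < 2) b k n * (1 - r k) / (r k * zeta b n k)))%:E)%E].
Proof.
have b_ge0 k n : 0 <= b k n by case/andP: (hb k n).
have b_le1 k n : b k n <= 1 by case/andP: (hb k n).
pose a (t : nat) : R :=
  4^-1 * \sum_(m < 2) \sum_(k < 2) mean_CU (b k) (r k) m t.
(* [arithmetic_mean] at [N] averages the [N.+1] terms of index 0 to [N]; shifting [a] by one matches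
   the times 1 to [N.+1]. *)
have meanS N : mean_CU_AoI beta gamma N.+1 =
    (arithmetic_mean (fun t => a t.+1) N)%:E.
  rewrite /mean_CU_AoI /arithmetic_mean /series /= big_add1 EFinM -sumEFin.
  congr (_ * _)%E; apply: eq_bigr => t _; rewrite /a EFinM -sumEFin.
  congr (_ * _)%E; apply: eq_bigr => m _; rewrite -sumEFin.
  by apply: eq_bigr => k _; rewrite (mean_CU_AoIE hOSR).
have a_le (u : 'I_2 -> R) : (forall m k t, mean_CU (b k) (r k) m t <= u k) ->
    forall t, a t <= 2^-1 * \sum_(k < 2) u k.
  move=> mu t; apply: (@le_trans _ _ (4^-1 * \sum_(m < 2) \sum_(k < 2) u k)).
    rewrite ler_wpM2l ?invr_ge0//.
    by apply: ler_sum => m _; apply: ler_sum => k _; exact: mu.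
  (* The bound does not depend on the user, so the two users turn 1/4 into 1/2. *)
  by rewrite sumr_const card_ord -mulr_natl; lra.
have le1 m k t : mean_CU (b k) (r k) m t <= (btot b k * r k)^-1.
  exact: mean_CU_le_inv (b_ge0 k) (hbtot k) (hr k) (hbr k) m t.
have le2 m k t : mean_CU (b k) (r k) m t <=
    (1 - btot b k + btot b k * r k) / (btot b k * r k) +
    \sum_(n < 2) b k n * (1 - r k) / (r k * zeta b n k).
  exact: mean_CU_le_eRRH (b_ge0 k) (hbtot k) (hr k) (hbr k) m t (b_le1 k)
    (hrz^~ k).
have a_nd : nondecreasing_seq (fun t => a t.+1).
  move=> s t st; rewrite ler_wpM2l ?invr_ge0//.
  apply: ler_sum => m _; apply: ler_sum => k _.
  exact: (mean_CU_nondecreasing (b_ge0 k) (hbtot k) (hr k)).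
have a_cvg : cvgn (fun t => a t.+1).
  apply: nondecreasing_is_cvgn => //.
  by exists (2^-1 * \sum_(k < 2) (btot b k * r k)^-1) => _ [t _ <-]; exact: a_le.
have mean_cvg : mean_CU_AoI beta gamma @ \oo -->
    (limn (fun t => a t.+1))%:E.
  (* Shifting discards the horizon 0, where [meanS] says nothing. *)
  rewrite -cvg_shiftS (_ : (fun N => _) =
    EFin \o arithmetic_mean (fun t => a t.+1)); last exact/funext.
  by apply: cvg_comp (cesaro a_cvg) _.
have avg_le u : (forall t, a t <= u) -> (avg_CU_AoI beta gamma <= u%:E)%E.
  move=> au; rewrite /avg_CU_AoI (cvg_lim _ mean_cvg)// lee_fin.
  by apply: limr_le => //; exact: nearW.
split; first by apply/cvg_ex; exists (limn (fun t => a t.+1))%:E.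
  exact/avg_le/a_le.
exact/avg_le/a_le.
Qed.
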